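(* The following two statements are equivalent: (i) for every finite simple graph $G$, $\eta(G) \ge \chi(G)$; (ii) for every finite simple split graph $H$, $\eta(H^2) \ge \chi(H^2)$.
   Context: All graphs are finite, undirected and simple. $\chi(G)$ denotes the chromatic number of $G$. A graph $M$ is a minor of $G$ if a graph isomorphic to $M$ can be obtained from a subgraph of $G$ by contracting edges; the Hadwiger number $\eta(G)$ is the largest integer $t$ such that $G$ has a minor isomorphic to the complete graph $K_t$. A split graph is a graph whose vertex set can be partitioned into an independent set and a clique. The square $G^2$ of a graph $G$ is the graph on $V(G)$ in which two distinct vertices are adjacent if and only if their distance in $G$ is $1$ or $2$. (Statement (i) is Hadwiger's conjecture.) *)

(* Defs.v *)
From HB Require Import structures.
From mathcomp Require Import all_boot.
From mathcomp Require Import boolp.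

Set Implicit Arguments.
Unset Strict Implicit.
Unset Printing Implicit Defensive.

Record sgraph := SGraph {
  svertex :> finType;
  sedge : rel svertex;
  sedge_sym : symmetric sedge;
  sedge_irrefl : irreflexive sedge
}.

Notation "x -- y" := (sedge x y) (at level 30).

Definition sg_iso (G H : sgraph) : Prop :=
  exists f : G -> H, bijective f /\ forall x y : G, (f x -- f y) = (x -- y).

Definition complete_rel (n : nat) : rel 'I_n := fun i j => i != j.

Lemma complete_sym n : symmetric (@complete_rel n).
Proof. by move=> i j; rewrite /complete_rel eq_sym. Qed.

Lemma complete_irrefl n : irreflexive (@complete_rel n).
Proof. by move=> i; rewrite /complete_rel eqxx. Qed.

Definition complete (n : nat) : sgraph :=
  SGraph (@complete_sym n) (@complete_irrefl n).

Definition proper_coloring (G : sgraph) (k : nat) (f : {ffun G -> 'I_k}) : bool :=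
  [forall x, forall y, (x -- y) ==> (f x != f y)].

Definition colorable (G : sgraph) (k : nat) : bool :=
  [exists f : {ffun G -> 'I_k}, proper_coloring f].

Lemma ex_colorable (G : sgraph) : exists k, colorable G k.
Proof.
exists #|G|; apply/existsP; exists [ffun x => enum_rank x].
apply/forallP => x; apply/forallP => y; apply/implyP => xy; rewrite !ffunE.
by apply/eqP => /enum_rank_inj eq_xy; rewrite eq_xy sedge_irrefl in xy.
Qed.

Definition chromatic_number (G : sgraph) : nat := ex_minn (ex_colorable G).

(* Pairs of [sub_edge] outside [sub_verts] are discarded by [graph_of_subgraph]. *)
Record subgraph (G : sgraph) := Subgraph {
  sub_verts : {set G};
  sub_edge : rel G;
  sub_edge_sym : symmetric sub_edge;
  sub_edge_sub : subrel sub_edge (@sedge G)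
}.

Section SubgraphToGraph.
Variables (G : sgraph) (S : subgraph G).

Definition graph_of_subgraph_rel : rel {x : G | x \in sub_verts S} :=
  fun u v => sub_edge S (val u) (val v).

Lemma graph_of_subgraph_sym : symmetric graph_of_subgraph_rel.
Proof. by move=> u v; apply: sub_edge_sym. Qed.

Lemma graph_of_subgraph_irrefl : irreflexive graph_of_subgraph_rel.
Proof.
move=> u; apply/negbTE/negP => /sub_edge_sub.
by rewrite sedge_irrefl.
Qed.

Definition graph_of_subgraph : sgraph :=
  SGraph graph_of_subgraph_sym graph_of_subgraph_irrefl.

End SubgraphToGraph.

(* [None] is the vertex that replaces both [x] and [y]; only meaningful when   *)
(* [x -- y], which [contracts] requires.                                       *)
Section Contract.
Variables (G : sgraph) (x y : G).

Definition contract_rel : rel (option {z : G | z \notin [set x; y]}) :=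
  fun u v => match u, v with
  | Some a, Some b => val a -- val b
  | Some a, None => (val a -- x) || (val a -- y)
  | None, Some b => (val b -- x) || (val b -- y)
  | None, None => false
  end.

Lemma contract_sym : symmetric contract_rel.
Proof. by move=> [u|] [v|] //=; rewrite sedge_sym. Qed.

Lemma contract_irrefl : irreflexive contract_rel.
Proof. by move=> [u|] //=; rewrite sedge_irrefl. Qed.

Definition contract : sgraph := SGraph contract_sym contract_irrefl.

End Contract.

Inductive contracts (G : sgraph) : sgraph -> Prop :=
| contracts_refl : contracts G G
| contracts_step (H : sgraph) (x y : H) :
    contracts G H -> x -- y -> contracts G (contract x y).

Definition minor (M G : sgraph) : Prop :=
  exists (S : subgraph G) (H : sgraph),
    contracts (graph_of_subgraph S) H /\ sg_iso H M.

Lemma ex_complete_minor (G : sgraph) : exists t, `[< minor (complete t) G >].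
Proof.
exists 0; apply/asboolP.
have F_sym : symmetric (fun _ _ : G => false) by [].
have F_sub : subrel (fun _ _ : G => false) (@sedge G) by [].
pose S := @Subgraph G set0 _ F_sym F_sub.
exists S, (graph_of_subgraph S); split; first exact: contracts_refl.
have no (u : graph_of_subgraph S) : False by case: u => u /=; rewrite inE.
exists (fun u => False_rect 'I_0 (no u)); split; last by move=> u; case: (no u).
by exists (fun i : 'I_0 => False_rect _ (notF (ltn_ord i))) => [u|[]//]; case: (no u).
Qed.

Lemma contracts_card (G H : sgraph) : contracts G H -> #|H| <= #|G|.
Proof.
elim=> // {}H x y _ leHG xy; apply: leq_trans leHG.
have neq_xy : x != y by apply: contraTneq xy => ->; rewrite sedge_irrefl.
rewrite /= card_option card_sig -(cardC [in [set x; y]]) cards2 neq_xy.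
by rewrite addSn add1n ltnS leqW.
Qed.

Lemma complete_minor_bound (G : sgraph) (t : nat) :
  `[< minor (complete t) G >] -> t <= #|G|.
Proof.
move/asboolP=> [S [H [/contracts_card leHS [f [bij_f _]]]]].
rewrite -[t]card_ord -(bij_eq_card bij_f); apply: leq_trans leHS _.
by rewrite /= card_sig max_card.
Qed.

Definition hadwiger_number (G : sgraph) : nat :=
  ex_maxn (ex_complete_minor G) (@complete_minor_bound G).

Definition independent (G : sgraph) (A : {set G}) : Prop :=
  forall x y, x \in A -> y \in A -> ~~ (x -- y).

Definition clique (G : sgraph) (A : {set G}) : Prop :=
  forall x y, x \in A -> y \in A -> x != y -> x -- y.

Definition split_graph (G : sgraph) : Prop :=
  exists A : {set G}, independent A /\ clique (~: A).

Definition walk_of_length (G : sgraph) (d : nat) (x y : G) : bool :=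
  [exists p : d.-tuple G, path (@sedge G) x p && (last x p == y)].

Definition at_distance (G : sgraph) (d : nat) (x y : G) : bool :=
  walk_of_length d x y && [forall j : 'I_d, ~~ walk_of_length j x y].

Definition square_rel (G : sgraph) : rel G :=
  fun x y => (x != y) && (at_distance 1 x y || at_distance 2 x y).

Lemma walk_of_length_sym (G : sgraph) d : symmetric (@walk_of_length G d).
Proof.
have half (x y : G) : walk_of_length d x y -> walk_of_length d y x.
  case/existsP => p /andP[px /eqP <-].
  have sz : size (rev (belast x p)) == d by rewrite size_rev size_belast size_tuple.
  apply/existsP; exists (Tuple sz); rewrite /= rev_path.
  rewrite (eq_path (e' := @sedge G)) ?px; last by move=> u v; rewrite sedge_sym.
  by case: (val p) => //= a s; rewrite rev_cons last_rcons eqxx.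
by move=> x y; apply/idP/idP; apply: half.
Qed.

Lemma square_sym (G : sgraph) : symmetric (@square_rel G).
Proof.
have dsym d : symmetric (@at_distance G d).
  move=> x y; rewrite /at_distance walk_of_length_sym; congr (_ && _).
  by apply: eq_forallb => j; rewrite walk_of_length_sym.
by move=> x y; rewrite /square_rel eq_sym (dsym 1) (dsym 2).
Qed.

Lemma square_irrefl (G : sgraph) : irreflexive (@square_rel G).
Proof. by move=> x; rewrite /square_rel eqxx. Qed.

Definition square (G : sgraph) : sgraph :=
  SGraph (@square_sym G) (@square_irrefl G).

(* Main.v *)
(* Given [G], let [H] be the split graph with independent part [V(G)] and
   clique part [V(G) * V(G)], where [x] is joined to the pair [(a, b)] when
   [x] is [a] or [b] and [a], [b] are equal or adjacent.  Distinct vertices of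
   [G] have a common neighbour in [H] exactly when they are adjacent in [G],
   and each [x] has the neighbour [(x, x)], so [H^2] is the join of [G] with a
   clique on [m = |V(G)|^2] vertices.  Joining [m] universal vertices raises
   the chromatic number by at least [m]; and deleting [m] vertices destroys at
   most [m] branch sets of a clique minor, so it lowers the Hadwiger number by
   at most [m]. *)
Require Import Defs.
From mathcomp Require Import all_boot.
From mathcomp Require Import boolp.

Set Implicit Arguments.
Unset Strict Implicit.
Unset Printing Implicit Defensive.

(** * Branch sets *)

Definition fibre_edge (G : sgraph) (T : eqType) (f : G -> T) : rel G :=
  fun a b => (a -- b) && (f a == f b).

(** Only the fibres over [D] are constrained, so the vertices that belong to no branch set may be
    scattered. *)
Definition connected_fibres (G : sgraph) (T : eqType) (D : {pred T})
    (f : G -> T) : Prop :=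
  forall x y, f x = f y -> f x \in D -> connect (fibre_edge f) x y.

(* The fibres over [J] are the branch sets of a minor [K_#|J|]; the vertices
   mapped outside [J] are the unused ones. *)
Definition clique_model (G : sgraph) (T : finType) (J : {set T}) (f : G -> T) :=
  [/\ forall i, i \in J -> exists x, f x = i,
      connected_fibres J f &
      forall i j, i \in J -> j \in J -> i != j ->
        exists x y, [/\ f x = i, f y = j & x -- y]].

Lemma fibre_edge_sym (G : sgraph) (T : eqType) (f : G -> T) :
  symmetric (fibre_edge f).
Proof. by move=> a b; rewrite /fibre_edge sedge_sym eq_sym. Qed.

Lemma homo_connect (A B : finType) (e : rel A) (e' : rel B) (h : A -> B) :
  {homo h : a b / e a b >-> connect e' a b} ->
  {homo h : a b / connect e a b >-> connect e' a b}.
Proof.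
move=> he a b /connectP[p]; elim: p a => [|c p IHp] a /=.
  by move=> _ ->; apply: connect0.
move=> /andP[ac cp] eq_b; apply: connect_trans (he _ _ ac) _; exact: IHp.
Qed.

Lemma contracts_trans (G H K : sgraph) :
  contracts G H -> contracts H K -> contracts G K.
Proof. by move=> GH; elim=> // L x y _ GL xy; apply: contracts_step. Qed.

Section ContractMap.
Variables (G : sgraph) (x y : G).
Hypothesis xy : x -- y.

(** The quotient map: [insub] fails exactly at [x] and [y], which therefore both go to the merged
    vertex [None]. *)
Definition contract_map (z : G) : contract x y := insub z.

Lemma contract_map_None z : (contract_map z == None) = (z \in [set x; y]).
Proof. by rewrite /contract_map; case: insubP => [u /negbTE|/negPn] ->. Qed.

Lemma contract_map_Some (u : {z : G | z \notin [set x; y]}) :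
  contract_map (val u) = Some u.
Proof. exact: valK. Qed.

Lemma contract_mapl : contract_map x = None.
Proof. by apply/eqP; rewrite contract_map_None set21. Qed.

Lemma contract_mapr : contract_map y = None.
Proof. by apply/eqP; rewrite contract_map_None set22. Qed.

Lemma contract_map_inj a b :
  contract_map a = contract_map b ->
  a = b \/ (a \in [set x; y]) /\ (b \in [set x; y]).
Proof.
move=> ab; case: (boolP (a \in [set x; y])) => aN.
  by right; split; rewrite // -contract_map_None -ab contract_map_None.
left; move: ab; rewrite /contract_map (insubT (fun z => z \notin _) aN).
by case: insubP => // u _ <- [<-].
Qed.

Lemma contract_map_surj u : exists a, contract_map a = u.
Proof.
by case: u => [a|]; [exists (val a); apply: valK | exists x; apply: contract_mapl].
Qed.

Lemma contract_map_edge a b :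
  a -- b -> contract_map a = contract_map b \/ contract_map a -- contract_map b.
Proof.
move=> ab; rewrite /contract_map.
case: insubP => [u _ ua|/negPn aN]; case: insubP => [v _ vb|/negPn bN].
- by right; rewrite /= ua vb.
- by right; move: bN; rewrite /= ua !inE => /orP[]/eqP <-; rewrite ab ?orbT.
- right; move: aN; rewrite /= vb !inE (sedge_sym b x) (sedge_sym b y).
  by move=> /orP[]/eqP <-; rewrite ab ?orbT.
- by left.
Qed.

Lemma contract_edge_lift (u v : contract x y) : u -- v ->
  exists a b, [/\ contract_map a = u, contract_map b = v & a -- b].
Proof.
case: u => [u|]; case: v => [v|] //=.
- by move=> uv; exists (val u), (val v); rewrite !contract_map_Some.
- case/orP=> uv.
    by exists (val u), x; rewrite contract_map_Some contract_mapl.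
  by exists (val u), y; rewrite contract_map_Some contract_mapr.
- rewrite (sedge_sym (val v) x) (sedge_sym (val v) y); case/orP=> uv.
    by exists x, (val v); rewrite contract_map_Some contract_mapl.
  by exists y, (val v); rewrite contract_map_Some contract_mapr.
Qed.

Lemma card_contract : #|contract x y| < #|G|.
Proof.
have neq_xy : x != y by apply: contraTneq xy => ->; rewrite sedge_irrefl.
rewrite /= card_option card_sig -(cardC [in [set x; y]]) cards2 neq_xy.
by rewrite addSn add1n.
Qed.

End ContractMap.

(** Each contraction composes [f] with one more quotient map. Only the fibre over the merged vertex
    is new: it is the union of the fibres over the two ends of the contracted edge, joined by a lift
    of that edge. *)
Lemma contracts_fibres (G H : sgraph) : contracts G H ->
  exists f : G -> H, [/\ forall u, exists x, f x = u,
    connected_fibres predT f &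
    forall u v, u -- v -> exists x y, [/\ f x = u, f y = v & x -- y]].
Proof.
elim=> [|{}H x y _ [f [f_surj f_conn f_edge]] xy].
  exists id; split=> [u|a b <- _|u v uv]; first by exists u.
    exact: connect0.
  by exists u, v.
exists (fun a => contract_map x y (f a)); split=> [u|a b ab _|u v uv].
- by have [z <-] := contract_map_surj u; have [a <-] := f_surj z; exists a.
- set e := fibre_edge _.
  have fe c d : f c = f d -> connect e c d.
    move=> cd; apply: connect_sub (f_conn c d cd isT) => c' d' /andP[cd' /eqP eq_f].
    by apply: connect1; rewrite /e /fibre_edge cd' eq_f eqxx.
  have [a' [b' [fa' fb' ab']]] := f_edge x y xy.
  have e_ab : e a' b'.
    by rewrite /e /fibre_edge ab' fa' fb' contract_mapl contract_mapr eqxx.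
  have e_ba : e b' a' by rewrite /e fibre_edge_sym.
  case: (contract_map_inj ab) => [/fe //|[]].
  (* If [f a] and [f b] are the same end, an old fibre suffices; otherwise the path crosses the
     lifted edge, in one direction or the other. *)
  rewrite !inE => /orP[]/eqP fa /orP[]/eqP fb; try by apply: fe; rewrite fa fb.
  + apply: connect_trans (fe a a' _) _; first by rewrite fa fa'.
    by apply: connect_trans (connect1 e_ab) _; apply: fe; rewrite fb.
  + apply: connect_trans (fe a b' _) _; first by rewrite fa fb'.
    by apply: connect_trans (connect1 e_ba) _; apply: fe; rewrite fb.
- have [c [d [<- <- /f_edge[a [b [<- <- ab]]]]]] := contract_edge_lift uv.
  by exists a, b.
Qed.

(** Vertices outside the subgraph go to [None], which [J] leaves out. *)
Lemma complete_minor_model (G : sgraph) t : minor (complete t) G ->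
  exists (T : finType) (J : {set T}) (f : G -> T), #|J| = t /\ clique_model J f.
Proof.
move=> [S [H [/contracts_fibres[f [f_surj f_conn f_edge]] [g [[h gK hK] g_edge]]]]].
pose F (x : G) : option 'I_t :=
  omap (fun u : graph_of_subgraph S => g (f u)) (insub x).
have FE (u : graph_of_subgraph S) : F (val u) = Some (g (f u)).
  by rewrite /F valK.
have FP x i : F x = Some i ->
    exists2 u : graph_of_subgraph S, val u = x & g (f u) = i.
  by rewrite /F; case: insubP => //= u _ <- [<-]; exists u.
exists (option 'I_t), [set Some i | i : 'I_t], F; split.
  by rewrite card_imset ?card_ord // => i j [].
split=> [_ /imsetP[i _ ->]|x y Fxy /imsetP[i _ Fx]|].
- by have [u fu] := f_surj (h i); exists (val u); rewrite FE fu hK.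
- have [u ux gu] := FP _ _ Fx; have [|v vy gv] := FP y i; first by rewrite -Fxy.
  rewrite -ux -vy.
  have uv : f u = f v by apply: (can_inj gK); rewrite gu gv.
  apply: homo_connect (f_conn u v uv isT) => a b /andP[ab /eqP fab].
  by apply: connect1; rewrite /fibre_edge !FE fab eqxx andbT (sub_edge_sub ab).
- move=> _ _ /imsetP[i _ ->] /imsetP[j _ ->] ij; have hij : h i -- h j.
    by rewrite -g_edge !hK; apply: contra ij => /eqP ->.
  have [u [v [fu fv uv]]] := f_edge _ _ hij.
  by exists (val u), (val v); rewrite !FE fu fv !hK (sub_edge_sub uv).
Qed.

(** Induction on the number of vertices. If [f] is injective, the graph is already complete;
    otherwise some branch set contains an edge, and contracting it leaves a model over the same
    [J]. *)
Lemma total_clique_model_contracts (G : sgraph) (T : finType) (J : {set T})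
    (f : G -> T) :
  clique_model J f -> (forall x, f x \in J) ->
  exists2 H, contracts G H & sg_iso H (complete #|J|).
Proof.
have [n] := ubnP #|G|; elim: n => // n IHn in G f *.
move=> leGn [f_surj f_conn f_adj] fJ.
case: (boolP (injectiveb f)) => [/injectiveP f_inj|].
  exists G; first exact: contracts_refl.
  rewrite -[#|J|](card_sig (fun i => i \in J)).
  pose g x : complete #|{: {i | i \in J}}| :=
    enum_rank (Sub (f x) (fJ x) : {i | i \in J}).
  have g_inj : injective g by move=> a b /enum_rank_inj[] /f_inj.
  exists g; split=> [|a b].
    apply: inj_card_bij => //; rewrite card_ord -(card_imset _ f_inj) card_sig.
    apply/subset_leq_card/subsetP => i /f_surj[x <-]; exact: imset_f.
  rewrite /= /complete_rel (inj_eq g_inj); have [->|ab] := eqVneq a b.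
    by rewrite sedge_irrefl.
  have [|a' [b' [/f_inj -> /f_inj ->]] -> //] := f_adj _ _ (fJ a) (fJ b).
  by rewrite (inj_eq f_inj).
case/injectivePn=> x [y neq_xy eq_f].
(* The first edge of a path from [x] to [y] inside their common fibre. *)
have [z xz fxz] : exists2 z, x -- z & f x = f z.
  have /connectP[[|z p] /=] := f_conn x y eq_f (fJ x).
    by move=> _ eq_xy; rewrite eq_xy eqxx in neq_xy.
  by case/andP=> /andP[xz /eqP fxz]; exists z.
(* [f] factors through the contraction because [f x = f z]. *)
pose g (u : contract x z) := if u is Some a then f (val a) else f x.
have gE a : g (contract_map x z a) = f a.
  rewrite /contract_map; case: insubP => [u _ <- //|/negPn] /=.
  by rewrite !inE => /orP[]/eqP ->.
have [|||H zH Hiso] := IHn (contract x z) g.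
- exact: leq_trans (card_contract xz) _.
- split=> [i /f_surj[a <-]|u v guv _|i j iJ jJ ij].
  + by exists (contract_map x z a).
  + move: guv; have [a <-] := contract_map_surj u.
    have [b <-] := contract_map_surj v; rewrite !gE => fab.
    apply: homo_connect (f_conn a b fab (fJ a)) => c d /andP[cd /eqP fcd].
    case: (contract_map_edge x z cd) => [->|cd']; first exact: connect0.
    by apply: connect1; rewrite /fibre_edge cd' !gE fcd eqxx.
  + have [a [b [fa fb ab]]] := f_adj _ _ iJ jJ ij.
    exists (contract_map x z a), (contract_map x z b); rewrite !gE; split=> //.
    case: (contract_map_edge x z ab) => // eq_ab.
    by rewrite -fa -fb -!gE eq_ab eqxx in ij.
- by move=> u; have [a <-] := contract_map_surj u; rewrite gE.
exists H => //; apply: contracts_trans zH.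
by apply: contracts_step xz; apply: contracts_refl.
Qed.

(** On the subgraph induced by the vertices mapped into [J] the model becomes total, and it stays
    connected because a path inside a branch set never leaves that subgraph. *)
Lemma clique_model_minor (G : sgraph) (T : finType) (J : {set T}) (f : G -> T) :
  clique_model J f -> minor (complete #|J|) G.
Proof.
move=> [f_surj f_conn f_adj].
pose S := @Subgraph G [set x | f x \in J] _ (@sedge_sym G) (fun _ _ => id).
have Sin x : f x \in J -> x \in sub_verts S by rewrite inE.
have [||H SH Hiso] :=
  @total_clique_model_contracts (graph_of_subgraph S) T J (fun u => f (val u)).
- split=> [i iJ|u v fuv fuJ|i j iJ jJ ij].
  + have [x fx] := f_surj i iJ; have xS : x \in sub_verts S by rewrite Sin ?fx.
    by exists (Sub x xS).
  + have /connectP[p] := f_conn _ _ fuv fuJ.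
    elim: p u fuJ {fuv} => [|c p IHp] u fuJ /=.
      by move=> _ /val_inj ->; apply: connect0.
    case/andP=> /andP[uc /eqP fuc] cp eq_v.
    have fcJ : f c \in J by rewrite -fuc.
    apply: (@connect_trans _ _ (Sub c (Sin c fcJ))); last exact: IHp.
    by apply: connect1; rewrite /fibre_edge /= fuc eqxx andbT.
  + have [x [y [fx fy xy]]] := f_adj _ _ iJ jJ ij.
    have xS : x \in sub_verts S by rewrite Sin ?fx.
    have yS : y \in sub_verts S by rewrite Sin ?fy.
    by exists (Sub x xS), (Sub y yS).
- by case=> x /=; rewrite inE.
by exists S, H.
Qed.

(** * Deleting vertices *)

Definition induced_embedding (G K : sgraph) (f : G -> K) : Prop :=
  injective f /\ forall x y, (f x -- f y) = (x -- y).

(** A branch set containing a vertex missed by [f] is discarded whole. The others lie inside the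
    image of [f], so their paths and adjacencies pull back. *)
Lemma clique_model_induced (G K : sgraph) (f : G -> K) (T : finType)
    (J : {set T}) (h : K -> T) :
  induced_embedding f -> clique_model J h ->
  clique_model (J :\: h @: [set c | c \notin codom f]) (h \o f).
Proof.
move=> [f_inj f_edge] [h_surj h_conn h_adj]; set D := h @: _.
have in_codom c : h c \notin D -> exists x, c = f x.
  move=> hD; case: (boolP (c \in codom f)) => [/codomP //|cN].
  by rewrite imset_f ?inE in hD.
split=> [i /setDP[iJ iD]|x y /= hxy /setDP[hJ hD]|].
- have [c hc] := h_surj i iJ; have [|x cx] := in_codom c; first by rewrite hc.
  by exists x; rewrite /= -cx.
- have /connectP[p] := h_conn _ _ hxy hJ.
  elim: p x hD {hxy hJ} => [|c p IHp] x hD /=.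
    by move=> _ /f_inj ->; apply: connect0.
  case/andP=> /andP[xc /eqP hxc] cp eq_y.
  have [|z cz] := in_codom c; first by rewrite -hxc.
  subst c; apply: (@connect_trans _ _ z); last by apply: IHp; rewrite // -hxc.
  by apply: connect1; rewrite /fibre_edge /= hxc eqxx -f_edge xc.
- move=> i j /setDP[iJ iD] /setDP[jJ jD] ij.
  have [c [d [hc hd cd]]] := h_adj _ _ iJ jJ ij.
  have [|x cx] := in_codom c; first by rewrite hc.
  have [|y dy] := in_codom d; first by rewrite hd.
  by exists x, y; rewrite /= -cx -dy -f_edge -cx -dy.
Qed.

(** Branch sets are disjoint, so each vertex missed by [f] spoils at most one of them. *)
Lemma hadwiger_number_induced (G K : sgraph) (f : G -> K) :
  induced_embedding f ->
  hadwiger_number K <= hadwiger_number G + #|[set c | c \notin codom f]|.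
Proof.
move=> f_emb; rewrite {1}/hadwiger_number.
case: ex_maxnP => t /asboolP/complete_minor_model[T [J [h [<- h_model]]]] _.
have /clique_model_minor/asboolP := clique_model_induced f_emb h_model.
rewrite /hadwiger_number; case: ex_maxnP => s _ max_s /max_s le_s.
rewrite -(cardsID (h @: [set c | c \notin codom f]) J) addnC.
rewrite leq_add //; apply: leq_trans (leq_imset_card h _).
exact/subset_leq_card/subsetIr.
Qed.

(** In a proper colouring of [K] the vertices missed by [f] get pairwise distinct colours that occur
    nowhere else, so the remaining colours suffice for [G]. *)
Lemma chromatic_number_universal (G K : sgraph) (f : G -> K) :
  induced_embedding f -> (forall c x, c \notin codom f -> x != c -> x -- c) ->
  chromatic_number G + #|[set c | c \notin codom f]| <= chromatic_number K.
Proof.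
move=> [f_inj f_edge] f_univ; rewrite {2}/chromatic_number.
case: ex_minnP => k /existsP[h /forallP h_col] _.
have hP x y : x -- y -> h x != h y.
  by move=> xy; have /forallP/(_ y)/implyP := h_col x; apply.
set C := [set c | _]; have h_inj : {in C &, injective h}.
  move=> c d _; rewrite inE => dC hcd; apply/eqP; apply: contraT => cd.
  by have := hP _ _ (f_univ d c dC cd); rewrite hcd eqxx.
have hD x : h (f x) \notin h @: C.
  apply/imsetP => -[c]; rewrite inE => cN hxc.
  have fxc : f x != c by apply: contraNneq cN => <-; apply: codom_f.
  by have := hP _ _ (f_univ c (f x) cN fxc); rewrite hxc eqxx.
have : colorable G #|{: {i | i \notin h @: C}}|.
  pose col x := enum_rank (Sub (h (f x)) (hD x) : {i | i \notin h @: C}).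
  apply/existsP; exists (finfun col).
  apply/forallP=> x; apply/forallP=> y; apply/implyP; rewrite -f_edge => /hP hxy.
  by rewrite !ffunE; apply: contra hxy => /eqP/enum_rank_inj[] ->.
rewrite card_sig /chromatic_number; case: ex_minnP => n _ min_n /min_n le_n.
rewrite -(card_in_imset h_inj) addnC.
apply: (@leq_trans #|'I_k|); last by rewrite card_ord.
by rewrite -(cardC [in h @: C]) leq_add2l.
Qed.

(** * The split graph of a graph *)

(** The minimality clauses of [at_distance] disappear: a walk of length 0 is excluded by [x != y],
    and a walk of length 1 already makes the right-hand side true. *)
Lemma squareE (G : sgraph) (x y : G) :
  square_rel x y = (x != y) && ((x -- y) || [exists z, (x -- z) && (z -- y)]).
Proof.
have walk0 : walk_of_length 0 x y = (x == y).
  apply/existsP/idP => [[p]|xy]; first by rewrite tuple0.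
  by exists [tuple].
have walk1 : walk_of_length 1 x y = (x -- y).
  apply/existsP/idP => [[[[|z []]] //= _]|xy].
    by rewrite andbT => /andP[xz /eqP <-].
  by exists [tuple y]; rewrite /= xy eqxx.
have walk2 : walk_of_length 2 x y = [exists z, (x -- z) && (z -- y)].
  apply/existsP/existsP => [[[[|z [|u []]]] //= _]|[z /andP[xz zy]]].
    by rewrite andbT => /andP[/andP[xz zu] /eqP <-]; exists z; rewrite xz.
  by exists [tuple z; y]; rewrite /= xz zy eqxx.
rewrite /square_rel; have [//|neq_xy] /= := eqVneq x y.
have dist1 : at_distance 1 x y = (x -- y).
  rewrite /at_distance walk1 andb_idr // => _.
  by apply/forallP => -[[|//] i]; rewrite /= walk0.
rewrite dist1; case: (boolP (x -- y)) => //= not_xy.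
rewrite /at_distance walk2 andb_idr // => _.
by apply/forallP => -[[|[|//]] i]; rewrite /= ?walk0 ?walk1.
Qed.

Section SplitOf.
Variable G : sgraph.

Definition incident (x : G) (p : G * G) : bool :=
  [&& (p.1 == p.2) || (p.1 -- p.2) & (x == p.1) || (x == p.2)].

Definition split_of_rel : rel (G + G * G) := fun u v =>
  match u, v with
  | inl _, inl _ => false
  | inl x, inr p | inr p, inl x => incident x p
  | inr p, inr q => p != q
  end.

Lemma split_of_sym : symmetric split_of_rel.
Proof. by move=> [x|p] [y|q] //=; rewrite eq_sym. Qed.

Lemma split_of_irrefl : irreflexive split_of_rel.
Proof. by move=> [x|p] //=; rewrite eqxx. Qed.

Definition split_of : sgraph := SGraph split_of_sym split_of_irrefl.

Lemma split_of_split : split_graph split_of.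
Proof.
exists [set u : split_of | if u is inl _ then true else false].
by split=> [[x|p] [y|q]|[x|p] [y|q]]; rewrite !inE.
Qed.

Definition split_of_vertex (x : G) : square split_of := inl x.

Lemma split_of_vertex_induced : induced_embedding split_of_vertex.
Proof.
split=> [x y [] //|x y]; rewrite [LHS]squareE /=.
apply/andP/idP => [[neq_xy /existsP[[//|[a b]]]]|xy].
  rewrite /incident /= => /andP[/andP[ab xp] /andP[_ yp]].
  have {}neq_xy : x != y by apply: contra neq_xy => /eqP ->.
  (* Being distinct, [x] and [y] are the two different entries of [(a, b)], which rules out [a = b]
     and leaves an edge. *)
  move: ab neq_xy; case/orP: xp => /eqP ->; case/orP: yp => /eqP ->;
    rewrite ?eqxx // => /orP[/eqP ->|]; rewrite ?eqxx // sedge_sym //.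
split; first by apply: contraTneq xy => -[->]; rewrite sedge_irrefl.
by apply/existsP; exists (inr (x, y)); rewrite /= /incident /= xy !eqxx !orbT.
Qed.

(** A pair is adjacent in [split_of] to every other pair and to its incident vertices. A vertex [x]
    not incident to [q] reaches it through [(x, x)], which differs from [q] for that very reason. *)
Lemma split_of_pair_universal (c u : square split_of) :
  c \notin codom split_of_vertex -> u != c -> u -- c.
Proof.
case: c => [x|q] cN uc; first by rewrite codom_f in cN.
rewrite /= squareE uc /=; case: u uc => [x|p] uc; last by apply/orP; left.
have [xq|xq] := boolP (incident x q); first by rewrite /= xq.
apply/orP; right; apply/existsP; exists (inr (x, x)).
rewrite /= /incident /= !eqxx /=.
by apply: contraNneq xq => <-; rewrite /incident /= !eqxx.
Qed.

End SplitOf.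

Theorem theorem1 :
  (forall G : sgraph, hadwiger_number G >= chromatic_number G) <->
  (forall H : sgraph, split_graph H ->
     hadwiger_number (square H) >= chromatic_number (square H)).
Proof.
split=> [hadwiger H _|hadwiger_split G]; first exact: hadwiger.
(* With m the number of vertices of H^2 outside the copy of G, the chain is chi(G) + m <= chi(H^2)
   <= eta(H^2) <= eta(G) + m, and m cancels. *)
have f_emb := split_of_vertex_induced G.
have := chromatic_number_universal f_emb (@split_of_pair_universal G).
move/leq_trans/(_ (hadwiger_split _ (split_of_split G))).
by move/leq_trans/(_ (hadwiger_number_induced f_emb)); rewrite leq_add2r.
Qed.
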